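(* Suppose $S=\emptyset$, i.e., $\bar u_i>0$ for all $i\in[n]$. For every $J\subseteq[n]\setminus[h]$ for which $M_J$ is invertible, let $N=[n]\setminus J$ and define $$A^J_{i,j}=-\left|(M_J^{-1})_{i,j}\,\bar u_j\right|\quad\text{for all } i,j\in J,$$ $$C^J_{i,j}=-\left|M_{i,J}(M_J^{-1})_{\cdot,j}\,\bar u_j\right|\quad\text{for all } i\in N,\ j\in J.$$ If there exists a subset $J\subseteq[n]\setminus[h]$ such that $M_J$ is invertible and $$\sum_{j\in J}A^J_{J,j}-M_J^{-1}\bar q_J\ge 0,$$ $$\sum_{j\in J}C^J_{N,j}-\bar u_N-M_{N,J}M_J^{-1}\bar q_J+\bar q_N\ge 0$$ hold, then there exists an AAR solution of the uncertain LCP $$0\le z(u)\perp Mz(u)+q(u)\ge 0\quad\text{for all } u\in\mathcal{U}.$$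
   Context: Notation: $[n]=\{1,\dots,n\}$ and $[h]=\{1,\dots,h\}$ ($[0]=\emptyset$). For a matrix $A$ and index sets $I,J$, $A_{I,J}$ is the submatrix with rows in $I$ and columns in $J$, $A_I=A_{I,I}$, $A_{i,\cdot}$ is the $i$-th row and $A_{\cdot,j}$ the $j$-th column; $b_I$ is the subvector of $b$ indexed by $I$. Rows and columns of $M_J^{-1}$ are indexed by $J$. Vector inequalities are componentwise, and $0\le a\perp b\ge 0$ means $a\ge0$, $b\ge0$, $a^\top b=0$. Data: $M\in\mathbb{R}^{n\times n}$, $\bar q\in\mathbb{R}^n$, $\bar u\in\mathbb{R}^n_{\ge0}$, $h\in\{0,\dots,n\}$. The uncertainty set is the box $\mathcal{U}=\{u\in\mathbb{R}^n: -\bar u_i\le u_i\le \bar u_i,\ i\in[n]\}$, and $q(u)=\bar q+u$ for $u\in\mathcal{U}$. Let $U=\{i\in[n]:\bar u_i>0\}$ and $S=\{i\in[n]:\bar u_i=0\}$. An affinely adjustable robust (AAR) solution of the uncertain LCP is an affine function $z(u)=Du+r$ with $D\in\mathbb{R}^{n\times n}$, $r\in\mathbb{R}^n$, $D_{[h],\cdot}=0$ (the first $h$ variables are non-adjustable) and, by convention, $D_{\cdot,S}=0$, such that $0\le z(u)\perp Mz(u)+q(u)\ge0$ for all $u\in\mathcal{U}$. *)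

(* Defs.v *)
From HB Require Import structures.
From mathcomp Require Import all_boot all_order all_algebra.
From mathcomp Require Import reals.

Set Implicit Arguments.
Unset Strict Implicit.
Unset Printing Implicit Defensive.

Import Order.TTheory GRing.Theory Num.Theory.
Local Open Scope ring_scope.

(* The rows and columns of A_{I,J} are numbered by 'I_#|I| and 'I_#|J| through
   enum_val, the enumeration of the set; position k of a subvector or of the
   inverse of a submatrix therefore stands for the original index enum_val k. *)
Definition restr_mx (R : Type) (m n : nat) (A : 'M[R]_(m, n))
    (I : {set 'I_m}) (J : {set 'I_n}) : 'M[R]_(#|I|, #|J|) :=
  mxsub (fun i : 'I_#|I| => enum_val i) (fun j : 'I_#|J| => enum_val j) A.

Definition restr_cv (R : Type) (n : nat) (b : 'cV[R]_n) (I : {set 'I_n}) :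
    'cV[R]_#|I| :=
  rowsub (fun i : 'I_#|I| => enum_val i) b.

(* Indices start at 0, so [h] = {1, ..., h} becomes {0, ..., h - 1}. *)
Definition initial (n h : nat) : {set 'I_n} := [set i : 'I_n | (i < h)%N].

Section RobustLCP.
Variables (R : realType) (n : nat).

Definition cv_ge0 (m : nat) (v : 'cV[R]_m) : Prop := forall i, 0 <= v i 0.

Definition complementary (a b : 'cV[R]_n) : Prop :=
  [/\ cv_ge0 a, cv_ge0 b & a^T *m b = 0].

Definition in_box (ubar u : 'cV[R]_n) : Prop :=
  forall i, - ubar i 0 <= u i 0 <= ubar i 0.

(* The set S of the indices whose data is certain. *)
Definition certain (ubar : 'cV[R]_n) : {set 'I_n} :=
  [set i | ubar i 0 == 0].

Definition affine_rule (D : 'M[R]_n) (r u : 'cV[R]_n) : 'cV[R]_n :=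
  D *m u + r.

Definition AAR_solution (M : 'M[R]_n) (qbar ubar : 'cV[R]_n) (h : nat)
    (D : 'M[R]_n) (r : 'cV[R]_n) : Prop :=
  [/\ forall i, i \in initial n h -> row i D = 0,
      forall j, j \in certain ubar -> col j D = 0 &
      forall u, in_box ubar u ->
        complementary (affine_rule D r u)
                      (M *m affine_rule D r u + (qbar + u))].

Definition AJ (M : 'M[R]_n) (ubar : 'cV[R]_n) (J : {set 'I_n}) :
    'M[R]_#|J| :=
  \matrix_(i, j) - `|invmx (restr_mx M J J) i j * restr_cv ubar J j 0|.

Definition CJ (M : 'M[R]_n) (ubar : 'cV[R]_n) (J : {set 'I_n}) :
    'M[R]_(#|~: J|, #|J|) :=
  \matrix_(i, j)
    - `|(row i (restr_mx M (~: J) J) *m col j (invmx (restr_mx M J J))) 0 0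
        * restr_cv ubar J j 0|.

End RobustLCP.

(* Main.v *)
(* Use the decision rule z_J(u) = - M_J^{-1} (q_J + u_J), z_N(u) = 0, so that
   (M z(u) + q(u))_J = 0 and complementarity is automatic. Over the box, the
   worst case of - B u is attained row by row and equals
   - \sum_j |B i j * ubar j|; taking B = M_J^{-1} and B = M_{N,J} M_J^{-1}, the
   two hypotheses are exactly z_J(u) >= 0 and (M z(u) + q(u))_N >= 0. *)
Require Import Defs.
From mathcomp Require Import all_boot all_order all_algebra.
From mathcomp Require Import reals.

Import Order.TTheory GRing.Theory Num.Theory.
Local Open Scope ring_scope.

(** The 0/1 matrix whose left multiplication restricts a vector to [J] and whose transpose extends
    by zero off [J]; identities between subvectors and submatrices thus become matrix algebra. *)
Definition sel_mx (R : pzSemiRingType) (n : nat) (J : {set 'I_n}) :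
    'M[R]_(#|J|, n) :=
  rowsub (fun k : 'I_#|J| => enum_val k) 1%:M.

Arguments sel_mx R [n] J.

Lemma restr_cvE {R : pzSemiRingType} {n : nat} (J : {set 'I_n}) (b : 'cV[R]_n) :
  restr_cv b J = sel_mx R J *m b.
Proof. by rewrite /restr_cv -{1}(mul1mx b) -mul_rowsub_mx. Qed.

Lemma restr_mxE {R : comPzRingType} {m n : nat} (M : 'M[R]_(m, n))
    (I : {set 'I_m}) (J : {set 'I_n}) :
  restr_mx M I J = sel_mx R I *m M *m (sel_mx R J)^T.
Proof.
rewrite mul_rowsub_mx mul1mx; apply/matrixP => i j; rewrite !mxE.
rewrite (bigD1 (enum_val j)) //= big1 => [|k neq_kj]; rewrite !mxE.
  by rewrite eqxx mulr1 addr0.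
by rewrite eq_sym (negbTE neq_kj) mulr0.
Qed.

Lemma sel_mxK {R : comPzRingType} {n : nat} (J : {set 'I_n}) :
  sel_mx R J *m (sel_mx R J)^T = 1%:M.
Proof.
(* The product is the [J]-submatrix of the identity, which is again an identity because [enum_val]
   is injective. *)
rewrite -[X in X *m _]mulmx1 -restr_mxE; apply/matrixP => i j.
by rewrite !mxE (inj_eq enum_val_inj).
Qed.

Lemma row_sel_mx_tr {R : pzSemiRingType} {n : nat} (J : {set 'I_n}) i :
  i \notin J -> row i (sel_mx R J)^T = 0.
Proof.
move=> iNJ; apply/rowP => k; rewrite !mxE.
by case: eqP iNJ => // <-; rewrite enum_valP.
Qed.

Lemma restr_cv_enum_rank {R : Type} {n : nat} {b : 'cV[R]_n} {J : {set 'I_n}}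
    {i} (iJ : i \in J) :
  restr_cv b J (enum_rank_in iJ i) 0 = b i 0.
Proof. by rewrite mxE enum_rankK_in. Qed.

Lemma cv_ge0_restr {R : realType} {n : nat} {b : 'cV[R]_n} (J : {set 'I_n}) :
  cv_ge0 (restr_cv b J) -> cv_ge0 (restr_cv b (~: J)) -> cv_ge0 b.
Proof.
move=> bJ bN i; have [iJ|] := boolP (i \in J).
  by rewrite -(restr_cv_enum_rank iJ).
by rewrite -in_setC => iN; rewrite -(restr_cv_enum_rank iN).
Qed.

Lemma in_box_restr {R : realType} {n : nat} {ubar u : 'cV[R]_n} (J : {set 'I_n}) :
  in_box ubar u -> in_box (restr_cv ubar J) (restr_cv u J).
Proof. by move=> box k; rewrite !mxE. Qed.

(** Termwise, [B i j * u j] is at most [|B i j| * |u j|], and the box gives [|u j| <= v j <= |v j|].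
    The matrix [A] is left abstract so that both [AJ] and [CJ] can take its place. *)
Lemma in_box_mulmx_ge {R : realType} {m n : nat} (B A : 'M[R]_(m, n))
    (v u : 'cV[R]_n) i :
    (forall i j, A i j = - `|B i j * v j 0|) -> in_box v u ->
  (\sum_(j < n) col j A) i 0 <= - (B *m u) i 0.
Proof.
move=> AE box; rewrite summxE mxE -sumrN; apply: ler_sum => j _.
rewrite mxE AE lerN2 (le_trans (ler_norm _)) // !normrM ler_wpM2l //.
rewrite (le_trans _ (ler_norm _)) // ler_norml; exact: box.
Qed.

Section DecisionRule.
Variables (R : realType) (n : nat) (M : 'M[R]_n) (qbar ubar u : 'cV[R]_n).
Variable J : {set 'I_n}.
Let V := invmx (restr_mx M J J).
Let D : 'M[R]_n := - ((sel_mx R J)^T *m V *m sel_mx R J).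
(** The intercept [D *m qbar] makes the rule [D *m (qbar + u)]: nominal data and perturbation enter
    together. *)
Let z := affine_rule D (D *m qbar) u.
Let w := M *m z + (qbar + u).

Let zE : z = - ((sel_mx R J)^T *m (V *m restr_cv (qbar + u) J)).
Proof.
by rewrite /z /affine_rule -mulmxDr addrC /D mulNmx restr_cvE !mulmxA.
Qed.

Let restr_z : restr_cv z J = - (V *m restr_cv qbar J + V *m restr_cv u J).
Proof.
by rewrite restr_cvE zE mulmxN mulmxA sel_mxK mul1mx !restr_cvE !mulmxDr.
Qed.

Let z_out i : i \notin J -> z i 0 = 0.
Proof.
move=> iNJ; transitivity (row i z 0 0); first by rewrite [RHS]mxE.
by rewrite zE linearN /= row_mul row_sel_mx_tr // mul0mx oppr0 mxE.
Qed.

(** Only the columns of [M] in [J] meet nonzero entries of [z]. The set [I] is free: [I = J] gives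
    zero once [M_J] is invertible, and [I = ~: J] gives the slack to be bounded. *)
Let restr_w (I : {set 'I_n}) :
  restr_cv w I = restr_cv (qbar + u) I
                 - restr_mx M I J *m V *m restr_cv (qbar + u) J.
Proof.
rewrite [LHS]restr_cvE /w zE mulmxDr addrC !mulmxN (restr_cvE I).
by rewrite (restr_mxE M I) !mulmxA.
Qed.

Lemma decision_rule_complementary :
    restr_mx M J J \in unitmx -> in_box ubar u ->
    cv_ge0 (\sum_(j < #|J|) col j (AJ M ubar J) - V *m restr_cv qbar J) ->
    cv_ge0 (\sum_(j < #|J|) col j (CJ M ubar J) - restr_cv ubar (~: J)
            - restr_mx M (~: J) J *m V *m restr_cv qbar J
            + restr_cv qbar (~: J)) ->
  complementary z w.
Proof.
move=> unitJ box geA geC.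
have wJ : restr_cv w J = 0 by rewrite restr_w mulmxV // mul1mx subrr.
have boxJ := in_box_restr J box.
split.
- apply: (cv_ge0_restr J) => i; last by rewrite mxE z_out // -in_setC enum_valP.
  have AE k j : AJ M ubar J k j = - `|V k j * restr_cv ubar J j 0|.
    by rewrite mxE.
  rewrite restr_z opprD addrC; apply: le_trans (geA i) _.
  by rewrite mxE [leRHS]mxE lerD2r [leRHS]mxE (in_box_mulmx_ge _ _ _ _ i AE).
- apply: (cv_ge0_restr J) => i; first by rewrite wJ mxE.
  set B := restr_mx M (~: J) J *m V.
  have CE k j : CJ M ubar J k j = - `|B k j * restr_cv ubar J j 0|.
    rewrite mxE /B; congr (- `|_ * _|); rewrite !mxE.
    by apply: eq_bigr => l _; rewrite !mxE.
  have leC := in_box_mulmx_ge _ _ _ _ i CE boxJ.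
  have /andP[leu _] := in_box_restr (~: J) box i.
  apply: le_trans (geC i) _; rewrite restr_w -/B.
  (* The terms are reordered to match [geC]: the two containing [u] come first, bounded below by the
     row sums of [CJ] and by [- ubar]; the nominal ones then cancel. *)
  have -> : restr_cv (qbar + u) (~: J) - B *m restr_cv (qbar + u) J =
            - (B *m restr_cv u J) + restr_cv u (~: J)
            - B *m restr_cv qbar J + restr_cv qbar (~: J).
    rewrite !restr_cvE !mulmxDr opprD [RHS]addrC -addrA; congr (_ + _).
    by rewrite [X in _ + X]addrC addrA [X in X - _]addrC.
  have addE (a b : 'cV[R]_#|~: J|) : (a + b) i 0 = a i 0 + b i 0 by rewrite mxE.
  have oppE (a : 'cV[R]_#|~: J|) : (- a) i 0 = - a i 0 by rewrite mxE.
  by rewrite !addE !oppE !lerD2r lerD.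
(* Every summand of the scalar product vanishes: [w] is zero on [J], and [z] is zero off [J]. *)
apply/matrixP => i j; rewrite !ord1 [LHS]mxE big1 ?mxE // => k _.
rewrite [_^T _ _]mxE; have [kJ|kNJ] := boolP (k \in J); last first.
  by rewrite z_out // mul0r.
have -> : w k 0 = 0 by rewrite -(restr_cv_enum_rank kJ) wJ mxE.
by rewrite mulr0.
Qed.

End DecisionRule.

Theorem corollary2 (R : realType) (n : nat) (M : 'M[R]_n)
    (qbar ubar : 'cV[R]_n) (h : nat)
    (h_le_n : (h <= n)%N)
    (ubar_ge0 : cv_ge0 ubar)
    (S_empty : certain ubar = set0) :
  (exists J : {set 'I_n},
     [/\ J \subset ~: initial n h,
         restr_mx M J J \in unitmx,
         cv_ge0 (\sum_(j < #|J|) col j (AJ M ubar J)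
                 - invmx (restr_mx M J J) *m restr_cv qbar J) &
         cv_ge0 (\sum_(j < #|J|) col j (CJ M ubar J)
                 - restr_cv ubar (~: J)
                 - restr_mx M (~: J) J *m invmx (restr_mx M J J) *m restr_cv qbar J
                 + restr_cv qbar (~: J))]) ->
  exists (D : 'M[R]_n) (r : 'cV[R]_n), AAR_solution M qbar ubar h D r.
Proof.
case=> J [sJ unitJ geA geC].
set D := - ((sel_mx R J)^T *m invmx (restr_mx M J J) *m sel_mx R J).
exists D, (D *m qbar); split => [i i_h|j|u box].
(* Non-adjustable indices lie outside [J], where extension by zero leaves zero rows in [D]. *)
- have iNJ : i \notin J by apply: contraL i_h => /(subsetP sJ); rewrite inE.
  by rewrite /D linearN /= !row_mul row_sel_mx_tr // !mul0mx oppr0.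
- by rewrite S_empty inE.
- exact: decision_rule_complementary geC.
Qed.
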